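(* Let $E,F$ be vector lattices with $F$ Dedekind complete, and let $A\subset\mathcal{U}_{+}(E,F)$ be an increasing set. Then for every $T\in\mathcal{U}_{+}(E,F)$ and every $e\in E$, $$\sigma_{A}T(e)=\inf_{\varepsilon>0,\ S\in A}\ \sup\bigl\{\rho\, T(f):\ f\in\mathcal{F}_{e},\ \rho\in\mathfrak{B}(F),\ \rho\, S(f)\leq\varepsilon\, S(e)\bigr\}.$$
   Context: For vector lattices $E,F$, an operator (not necessarily linear) $T:E\to F$ is orthogonally additive if $T(x+y)=T(x)+T(y)$ whenever $x\perp y$; it is positive if $T(x)\geq 0$ for all $x\in E$; it is order bounded if it maps order bounded sets to order bounded sets. An orthogonally additive order bounded operator is an abstract Uryson operator; $\mathcal{U}(E,F)$ denotes the space of all of them, $\mathcal{U}_{+}(E,F)$ the positive ones, ordered by $S\leq T$ iff $T-S$ is positive; for $F$ Dedekind complete, $\mathcal{U}(E,F)$ is a Dedekind complete vector lattice. A fragment of $x\in E$ is $z\in E$ with $z\perp(x-z)$; $\mathcal{F}_{x}$ is the set of fragments of $x$. $\mathfrak{B}(F)$ is the Boolean algebra of band projections on $F$. For $A\subset\mathcal{U}(E,F)$, $\pi_{A}$ denotes the band projection in $\mathcal{U}(E,F)$ onto the band $\{A\}^{\perp\perp}$ generated by $A$, and $\sigma_{A}=I-\pi_{A}$. A set $A\subset\mathcal{U}_{+}(E,F)$ is increasing if for all $S,T\in A$ there is $Q\in A$ with $S\leq Q$ and $T\leq Q$. *)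

(* Defs.v *)
From Stdlib Require Import Reals.
Open Scope R_scope.

Record VL : Type := {
  vl_car :> Type;
  vzero : vl_car;
  vadd : vl_car -> vl_car -> vl_car;
  vopp : vl_car -> vl_car;
  vscal : R -> vl_car -> vl_car;
  vle : vl_car -> vl_car -> Prop;
  vjoin : vl_car -> vl_car -> vl_car;
  vmeet : vl_car -> vl_car -> vl_car;
  vaddA : forall x y z, vadd x (vadd y z) = vadd (vadd x y) z;
  vaddC : forall x y, vadd x y = vadd y x;
  vadd0 : forall x, vadd x vzero = x;
  vaddN : forall x, vadd x (vopp x) = vzero;
  vscalDr : forall a x y, vscal a (vadd x y) = vadd (vscal a x) (vscal a y);
  vscalDl : forall a b x, vscal (a + b) x = vadd (vscal a x) (vscal b x);
  vscalA : forall a b x, vscal (a * b) x = vscal a (vscal b x);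
  vscal1 : forall x, vscal 1 x = x;
  vle_refl : forall x, vle x x;
  vle_antisym : forall x y, vle x y -> vle y x -> x = y;
  vle_trans : forall x y z, vle x y -> vle y z -> vle x z;
  vle_add : forall x y z, vle x y -> vle (vadd x z) (vadd y z);
  vle_scal : forall a x y, 0 <= a -> vle x y -> vle (vscal a x) (vscal a y);
  vjoin_l : forall x y, vle x (vjoin x y);
  vjoin_r : forall x y, vle y (vjoin x y);
  vjoin_lub : forall x y z, vle x z -> vle y z -> vle (vjoin x y) z;
  vmeet_l : forall x y, vle (vmeet x y) x;
  vmeet_r : forall x y, vle (vmeet x y) y;
  vmeet_glb : forall x y z, vle z x -> vle z y -> vle z (vmeet x y)
}.

Arguments vzero {v}.
Arguments vadd {v} _ _.
Arguments vopp {v} _.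
Arguments vscal {v} _ _.
Arguments vle {v} _ _.
Arguments vjoin {v} _ _.
Arguments vmeet {v} _ _.

Section VLDefs.
Variable V : VL.

Definition vabs (x : V) : V := vjoin x (vopp x).

Definition vdisj (x y : V) : Prop := vmeet (vabs x) (vabs y) = vzero.

Definition fragment (x z : V) : Prop := vdisj z (vadd x (vopp z)).

Definition is_ub (D : V -> Prop) (u : V) : Prop := forall x, D x -> vle x u.
Definition is_lb (D : V -> Prop) (l : V) : Prop := forall x, D x -> vle l x.
Definition is_sup (D : V -> Prop) (s : V) : Prop :=
  is_ub D s /\ forall u, is_ub D u -> vle s u.
Definition is_inf (D : V -> Prop) (i : V) : Prop :=
  is_lb D i /\ forall l, is_lb D l -> vle l i.

Definition dedekind_complete : Prop :=
  forall D : V -> Prop, (exists x, D x) -> (exists u, is_ub D u) ->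
    exists s, is_sup D s.

Definition ideal (B : V -> Prop) : Prop :=
  B vzero /\
  (forall x y, B x -> B y -> B (vadd x y)) /\
  (forall a x, B x -> B (vscal a x)) /\
  (forall x y, B x -> vle (vabs y) (vabs x) -> B y).

Definition band (B : V -> Prop) : Prop :=
  ideal B /\ forall D s, (forall x, D x -> B x) -> is_sup D s -> B s.

Definition disj_compl (B : V -> Prop) (y : V) : Prop := forall x, B x -> vdisj y x.

Definition band_projection (rho : V -> V) : Prop :=
  exists B : V -> Prop, band B /\
    forall x, B (rho x) /\ disj_compl B (vadd x (vopp (rho x))).
End VLDefs.

Arguments vabs {V} _.
Arguments vdisj {V} _ _.
Arguments fragment {V} _ _.
Arguments is_ub {V} _ _.
Arguments is_lb {V} _ _.
Arguments is_sup {V} _ _.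
Arguments is_inf {V} _ _.
Arguments ideal {V} _.
Arguments band {V} _.
Arguments disj_compl {V} _ _.
Arguments band_projection {V} _.

Section Operators.
Variables E F : VL.
Definition op := E -> F.

Definition orth_additive (T : op) : Prop :=
  forall x y : E, vdisj x y -> T (vadd x y) = vadd (T x) (T y).

Definition positive_op (T : op) : Prop := forall x, vle vzero (T x).

Definition order_bounded_op (T : op) : Prop :=
  forall a b : E, exists c d : F,
    forall x, vle a x -> vle x b -> vle c (T x) /\ vle (T x) d.

Definition uryson (T : op) : Prop := orth_additive T /\ order_bounded_op T.

Definition op_le (S T : op) : Prop := forall x, vle (S x) (T x).
Definition op_zero : op := fun _ => vzero.
Definition op_add (S T : op) : op := fun x => vadd (S x) (T x).
Definition op_opp (S : op) : op := fun x => vopp (S x).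

Definition U_lub (S1 S2 J : op) : Prop :=
  uryson J /\ op_le S1 J /\ op_le S2 J /\
  forall K, uryson K -> op_le S1 K -> op_le S2 K -> op_le J K.
Definition U_glb (S1 S2 M : op) : Prop :=
  uryson M /\ op_le M S1 /\ op_le M S2 /\
  forall K, uryson K -> op_le K S1 -> op_le K S2 -> op_le K M.

Definition U_disj (S T : op) : Prop :=
  exists a b, U_lub S (op_opp S) a /\ U_lub T (op_opp T) b /\ U_glb a b op_zero.

Definition U_disj_compl (X : op -> Prop) (P : op) : Prop :=
  uryson P /\ forall S, X S -> U_disj P S.

Definition U_band_gen (A : op -> Prop) : op -> Prop :=
  U_disj_compl (U_disj_compl A).

(** Sg = σ_A T = T - π_A T, where π_A is the band projection onto {A}^⊥⊥:
    T = π_A T + Sg with π_A T ∈ {A}^⊥⊥ and Sg ∈ ({A}^⊥⊥)^⊥ *)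
Definition is_sigma (A : op -> Prop) (T Sg : op) : Prop :=
  exists P, U_band_gen A P /\ U_disj_compl (U_band_gen A) Sg /\
    forall x, T x = vadd (P x) (Sg x).

Definition increasing_set (A : op -> Prop) : Prop :=
  forall S T, A S -> A T -> exists Q, A Q /\ op_le S Q /\ op_le T Q.

Definition inner_set (T S : op) (eps : R) (e : E) : F -> Prop :=
  fun z => exists (f : E) (rho : F -> F),
    fragment e f /\ band_projection rho /\
    vle (rho (S f)) (vscal eps (S e)) /\ z = rho (T f).

Definition outer_set (A : op -> Prop) (T : op) (e : E) : F -> Prop :=
  fun y => exists (eps : R) (S : op), 0 < eps /\ A S /\ is_sup (inner_set T S eps e) y.
End Operators.

Arguments op_le {E F} _ _.
Arguments uryson {E F} _.
Arguments positive_op {E F} _.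
Arguments is_sigma {E F} _ _ _.
Arguments increasing_set {E F} _.
Arguments outer_set {E F} _ _ _ _.

(* Main.v *)
(** The projection of T onto the band generated by A is, pointwise, the supremum
    P of T ∧ rS over r >= 0 and S in A, where
    (T ∧ rS)(e) = inf {T f + r S(e - f) : f a fragment of e}: the family is
    directed, so P is orthogonally additive, and both disjointness relations
    follow from (T ∧ rS) + K <= T ∧ (r + 1)Q for K <= T - P, K <= S and
    Q >= S in A.  Hence (T - P)(e) is the infimum over r, S of
    sup {T f - r S f : f a fragment of e}.

    If rho S f <= eps S e then rho T f <= (T - T ∧ rS)(e) + r eps S e; let eps
    tend to 0.  Conversely, let rho be the projection onto the complement of the
    band generated by (S f - eps S e)^+.  Then rho S f <= eps S e, while off rho
    one has T f - r S f <= T e - r eps S e, whose positive part, once projected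
    onto the band generated by S e, decreases to 0 as r grows. *)
Require Import Defs.
From Stdlib Require Import Reals Lra List Classical IndefiniteDescription.

Declare Scope vl_scope.
Delimit Scope vl_scope with V.
Bind Scope vl_scope with vl_car.
Notation "0" := vzero : vl_scope.
Notation "x + y" := (vadd x y) : vl_scope.
Notation "- x" := (vopp x) : vl_scope.
Notation "x - y" := (vadd x (vopp y)) : vl_scope.
Notation "r *: x" := (vscal r%R x) (at level 40) : vl_scope.
Notation "x <= y" := (vle x y) : vl_scope.
Notation "x ⊓ y" := (vmeet x y) (at level 45) : vl_scope.
Notation "x ⊔ y" := (vjoin x y) (at level 45) : vl_scope.

(** * Linear identities in a vector lattice, by reflection *)

Inductive vexpr : Type :=
| VVar : nat -> vexpr
| VZero : vexpr
| VAdd : vexpr -> vexpr -> vexpr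
| VOpp : vexpr -> vexpr
| VScal : R -> vexpr -> vexpr.

Fixpoint vcoef (e : vexpr) (i : nat) : R :=
  match e with
  | VVar n => if Nat.eqb n i then 1 else 0
  | VZero => 0
  | VAdd a b => vcoef a i + vcoef b i
  | VOpp a => - vcoef a i
  | VScal r a => r * vcoef a i
  end.

(** Recursion on the number of atoms lets [cbn] unfold the comparison into one real equation per
    atom, within reach of [ring] and [lra]. *)
Fixpoint coef_agree (n : nat) (c d : nat -> R) : Prop :=
  match n with
  | O => True
  | S m => c O = d O /\ coef_agree m (fun i => c (S i)) (fun i => d (S i))
  end.

Section LinearIdentities.
Variable V : VL.
Local Open Scope vl_scope.

Fixpoint veval (l : list V) (e : vexpr) : V :=
  match e with
  | VVar n => nth n l 0
  | VZero => 0
  | VAdd a b => veval l a + veval l b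
  | VOpp a => - veval l a
  | VScal r a => r *: veval l a
  end.

Fixpoint lin_comb (l : list V) (c : nat -> R) : V :=
  match l with
  | nil => 0
  | x :: l' => c O *: x + lin_comb l' (fun i => c (S i))
  end.

Lemma vadd_cancel (x y z : V) : x + z = y + z -> x = y.
Proof.
intros H.
rewrite <- (vadd0 _ x), <- (vadd0 _ y), <- (vaddN _ z), !vaddA, H.
reflexivity.
Qed.

Lemma vadd0l (x : V) : 0 + x = x.
Proof. rewrite vaddC; apply vadd0. Qed.

Lemma vscal0l (x : V) : 0 *: x = 0.
Proof.
apply (vadd_cancel _ _ (0 *: x)).
rewrite <- vscalDl, vadd0l; f_equal; lra.
Qed.

Lemma vscal0r (r : R) : r *: (0 : V) = 0.
Proof.
apply (vadd_cancel _ _ (r *: 0)).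
rewrite <- vscalDr, !vadd0l; reflexivity.
Qed.

Lemma vopp_scal (x : V) : - x = (-1) *: x.
Proof.
apply (vadd_cancel _ _ x).
rewrite (vaddC _ (- x)), vaddN.
rewrite <- (vscal1 _ x) at 2.
rewrite <- vscalDl, <- (vscal0l x); f_equal; lra.
Qed.

Lemma vaddACA (a b c d : V) : (a + b) + (c + d) = (a + c) + (b + d).
Proof.
rewrite <- !vaddA; f_equal; rewrite !vaddA; f_equal; apply vaddC.
Qed.

Lemma lin_combD (l : list V) c d :
  lin_comb l (fun i => c i + d i)%R = lin_comb l c + lin_comb l d.
Proof.
revert c d; induction l as [|x l IH]; intros c d; simpl.
- rewrite vadd0; reflexivity.
- rewrite (IH (fun i => c (S i)) (fun i => d (S i))), vscalDl; apply vaddACA.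
Qed.

Lemma lin_combZ (l : list V) r c :
  lin_comb l (fun i => r * c i)%R = r *: lin_comb l c.
Proof.
revert c; induction l as [|x l IH]; intros c; simpl.
- rewrite vscal0r; reflexivity.
- rewrite (IH (fun i => c (S i))), vscalDr, vscalA; reflexivity.
Qed.

Lemma lin_comb_ext (l : list V) c d :
  coef_agree (length l) c d -> lin_comb l c = lin_comb l d.
Proof.
revert c d; induction l as [|x l IH]; intros c d; simpl; [reflexivity|].
intros [-> H]; rewrite (IH _ _ H); reflexivity.
Qed.

Lemma coef_agree_ext n c d : (forall i, c i = d i) -> coef_agree n c d.
Proof.
revert c d; induction n as [|n IH]; intros c d H; simpl; auto.
Qed.

Lemma lin_comb0 (l : list V) : lin_comb l (fun _ => 0%R) = 0.
Proof.
induction l as [|x l IH]; simpl; [reflexivity|].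
rewrite IH, vscal0l, vadd0; reflexivity.
Qed.

Lemma veval_lin_comb (l : list V) e : veval l e = lin_comb l (vcoef e).
Proof.
induction e as [n| |a IHa b IHb|a IH|r a IH]; simpl.
(* An index past the end of the list evaluates to the default [0], in agreement with an empty
   sum. *)
- revert n; induction l as [|x l IH]; intros [|n]; simpl; try reflexivity.
  + rewrite vscal1, lin_comb0, vadd0; reflexivity.
  + rewrite vscal0l, vadd0l; apply IH.
- symmetry; apply lin_comb0.
- rewrite IHa, IHb; symmetry; apply lin_combD.
- rewrite IH, vopp_scal, <- lin_combZ.
  apply lin_comb_ext, coef_agree_ext; intros i; lra.
- rewrite IH; symmetry; apply lin_combZ.
Qed.

Lemma veval_eq (l : list V) e1 e2 :
  coef_agree (length l) (vcoef e1) (vcoef e2) -> veval l e1 = veval l e2.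
Proof. intros H; rewrite !veval_lin_comb; apply lin_comb_ext, H. Qed.

End LinearIdentities.

Ltac atom_index x l :=
  lazymatch l with
  | x :: _ => constr:(O)
  | _ :: ?l' => let n := atom_index x l' in constr:(S n)
  end.

(** New atoms go in front and shift the indices of the earlier ones, so [vring] reifies only once
    the list is complete. *)
Ltac add_atom x l :=
  match l with
  | _ => let _ := atom_index x l in l
  | _ => constr:(x :: l)
  end.

Ltac vatoms l t :=
  lazymatch t with
  | vzero => l
  | vadd ?a ?b => let l1 := vatoms l a in vatoms l1 b
  | vopp ?a => vatoms l a
  | vscal _ ?a => vatoms l a
  | _ => add_atom t l
  end.

Ltac vreify l t :=
  lazymatch t with
  | vzero => constr:(VZero)
  | vadd ?a ?b =>
      let e1 := vreify l a in let e2 := vreify l b in constr:(VAdd e1 e2)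
  | vopp ?a => let e := vreify l a in constr:(VOpp e)
  | vscal ?r ?a => let e := vreify l a in constr:(VScal r e)
  | _ => let n := atom_index t l in constr:(VVar n)
  end.

Ltac vring :=
  cbv beta;
  lazymatch goal with
  | |- @eq _ ?a ?b =>
      let V := lazymatch type of a with vl_car ?V => V end in
      let l0 := vatoms (@nil (vl_car V)) a in
      let l := vatoms l0 b in
      let e1 := vreify l a in
      let e2 := vreify l b in
      change (veval V l e1 = veval V l e2); apply veval_eq;
      cbn [coef_agree vcoef Nat.eqb length]; repeat split; try ring; try lra; try (field; lra)
  end.

(** * Vector lattices *)

Section VectorLattice.
Variable V : VL.
Local Open Scope vl_scope.
Implicit Types a b c d e f g h k s t u w x y z : V.

(** Reduces an inequality that follows linearly from a known one to a linear identity, which [vring]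
    decides; [vle_by] packages this. *)
Lemma le_transfer a b x y : a <= b -> x + b = y + a -> x <= y.
Proof.
intros H He.
replace x with (a + (y - b)).
- replace y with (b + (y - b)) at 2 by vring.
  apply vle_add, H.
- transitivity ((x + b) - b); [rewrite He|]; vring.
Qed.

Lemma leD a b c d : a <= b -> c <= d -> a + c <= b + d.
Proof.
intros H1 H2; apply (vle_trans _ _ (b + c)).
- apply vle_add, H1.
- rewrite !(vaddC _ b); apply vle_add, H2.
Qed.

End VectorLattice.

Arguments le_transfer {V a b x y}.
Arguments leD {V a b c d}.
Arguments vle_trans {v x y z}.
Arguments vle_scal {v a x y}.

Ltac vle_by H := apply (le_transfer H); vring.

Section VectorLatticeTheory.
Variable V : VL.
Local Open Scope vl_scope.
Implicit Types a b c d e f g h k s t u w x y z : V.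

Lemma scal_ge0 r x : (0 <= r)%R -> 0 <= x -> 0 <= r *: x.
Proof. intros Hr Hx; vle_by (vle_scal Hr Hx). Qed.

Lemma scal_le_scal r q x : (r <= q)%R -> 0 <= x -> r *: x <= q *: x.
Proof.
intros Hr Hx; assert (H : (0 <= q - r)%R) by lra.
vle_by (vle_scal H Hx).
Qed.

Lemma scal_le0 r x : (0 < r)%R -> r *: x <= 0 -> x <= 0.
Proof.
intros Hr Hx; assert (H : (0 <= / r)%R)
  by (left; apply Rinv_0_lt_compat, Hr).
vle_by (vle_scal H Hx).
Qed.

(** * Positive part and modulus *)

Definition vpos x := x ⊔ 0.

Lemma vpos_ge0 x : 0 <= vpos x.
Proof. apply vjoin_r. Qed.

Lemma vpos_ge x : x <= vpos x.
Proof. apply vjoin_l. Qed.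

Lemma vpos_lub x z : x <= z -> 0 <= z -> vpos x <= z.
Proof. apply vjoin_lub. Qed.

Lemma vpos_sub_vpos_opp x : vpos x - vpos (- x) = x.
Proof.
apply vle_antisym.
- assert (H : vpos x <= x + vpos (- x)).
  { apply vpos_lub; [vle_by (vpos_ge0 (- x))|vle_by (vpos_ge (- x))]. }
  vle_by H.
- assert (H : vpos (- x) <= vpos x - x).
  { apply vpos_lub; [vle_by (vpos_ge0 x)|vle_by (vpos_ge x)]. }
  vle_by H.
Qed.

Lemma vposN x : vpos (- x) = vpos x - x.
Proof. rewrite <- (vpos_sub_vpos_opp x) at 3; vring. Qed.

Lemma vpos_sub_meet x y : vpos (x - y) = x - (x ⊓ y).
Proof.
apply vle_antisym.
- apply vpos_lub; [vle_by (vmeet_r _ x y)|vle_by (vmeet_l _ x y)].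
- assert (H : x - vpos (x - y) <= x ⊓ y).
  { apply vmeet_glb; [vle_by (vpos_ge0 (x - y))|vle_by (vpos_ge (x - y))]. }
  vle_by H.
Qed.

Lemma le_vabs x : x <= vabs x.
Proof. apply vjoin_l. Qed.

Lemma opp_le_vabs x : - x <= vabs x.
Proof. apply vjoin_r. Qed.

Lemma vabs_lub x z : x <= z -> - x <= z -> vabs x <= z.
Proof. apply vjoin_lub. Qed.

Lemma vabs_ge0 x : 0 <= vabs x.
Proof.
assert (H : (0 <= 1 / 2)%R) by lra.
vle_by (vle_scal H (leD (le_vabs x) (opp_le_vabs x))).
Qed.

Lemma vabs_pos x : 0 <= x -> vabs x = x.
Proof.
intros H; apply vle_antisym; [|apply le_vabs].
apply vabs_lub; [apply vle_refl|vle_by (leD H H)].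
Qed.

Lemma vabsN x : vabs (- x) = vabs x.
Proof.
assert (H : forall y, vabs (- y) <= vabs y).
{ intros y; apply vabs_lub; [apply opp_le_vabs|vle_by (le_vabs y)]. }
apply vle_antisym; [apply H|].
replace x with (- - x) at 1 by vring; apply H.
Qed.

Lemma vabsD x y : vabs (x + y) <= vabs x + vabs y.
Proof.
apply vabs_lub; [exact (leD (le_vabs x) (le_vabs y))|].
vle_by (leD (opp_le_vabs x) (opp_le_vabs y)).
Qed.

Lemma vabsZ r x : vabs (r *: x) <= Rabs r *: vabs x.
Proof.
unfold Rabs; destruct (Rcase_abs r) as [Hr|Hr].
- assert (H : (0 <= - r)%R) by lra.
  apply vabs_lub;
    [vle_by (vle_scal H (opp_le_vabs x))|vle_by (vle_scal H (le_vabs x))].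
- assert (H : (0 <= r)%R) by lra.
  apply vabs_lub;
    [vle_by (vle_scal H (le_vabs x))|vle_by (vle_scal H (opp_le_vabs x))].
Qed.

Lemma vpos_le_vabs x : vpos x <= vabs x.
Proof. apply vpos_lub; [apply le_vabs|apply vabs_ge0]. Qed.

Lemma vpos_opp_le_vabs x : vpos (- x) <= vabs x.
Proof. rewrite <- vabsN; apply vpos_le_vabs. Qed.

Lemma vabs_split x : vabs x <= vpos x + vpos (- x).
Proof.
apply vabs_lub;
  [vle_by (leD (vpos_ge x) (vpos_ge0 (- x)))
  |vle_by (leD (vpos_ge0 x) (vpos_ge (- x)))].
Qed.

(** * Disjointness *)

Lemma vmeetC x y : x ⊓ y = y ⊓ x.
Proof.
apply vle_antisym; apply vmeet_glb; auto using vmeet_l, vmeet_r.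
Qed.

Lemma vmeet_ge0 x y : 0 <= x -> 0 <= y -> 0 <= x ⊓ y.
Proof. apply vmeet_glb. Qed.

(** The test element [k] may have any sign, so differences such as [k - vabs z] can be fed to it
    directly. *)
Lemma vdisjP x y :
  vdisj x y <-> forall k, k <= vabs x -> k <= vabs y -> k <= 0.
Proof.
split.
- intros H k H1 H2; rewrite <- H; apply vmeet_glb; assumption.
- intros H; apply vle_antisym.
  + apply H; [apply vmeet_l|apply vmeet_r].
  + apply vmeet_ge0; apply vabs_ge0.
Qed.

Lemma vdisj_sym x y : vdisj x y -> vdisj y x.
Proof. unfold vdisj; rewrite vmeetC; auto. Qed.

Lemma vdisj_le x y x' y' :
  vabs x' <= vabs x -> vabs y' <= vabs y -> vdisj x y -> vdisj x' y'.
Proof.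
rewrite !vdisjP; intros H1 H2 H k Hk1 Hk2.
apply H; [exact (vle_trans Hk1 H1)|exact (vle_trans Hk2 H2)].
Qed.

Lemma vdisj_addr x y z : vdisj x y -> vdisj x z -> vdisj x (y + z).
Proof.
rewrite !vdisjP; intros H1 H2 k Hk1 Hk2.
apply H2; [assumption|].
(* What [k] has in excess of [vabs z] lies below both [vabs x] and [vabs y]. *)
assert (H : k - vabs z <= 0).
{ apply H1; [vle_by (leD Hk1 (vabs_ge0 z))|].
  vle_by (vle_trans Hk2 (vabsD y z)). }
vle_by H.
Qed.

Lemma vdisj_addl x y z : vdisj x z -> vdisj y z -> vdisj (x + y) z.
Proof.
intros H1 H2; apply vdisj_sym, vdisj_addr; apply vdisj_sym; assumption.
Qed.

Lemma vdisj_oppr x y : vdisj x y -> vdisj x (- y).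
Proof. unfold vdisj; rewrite vabsN; auto. Qed.

Lemma vdisj_oppl x y : vdisj x y -> vdisj (- x) y.
Proof. unfold vdisj; rewrite vabsN; auto. Qed.

Lemma vdisj_scall r x y : vdisj x y -> vdisj (r *: x) y.
Proof.
rewrite !vdisjP; intros H k Hk1 Hk2.
(* [q] dominates both [Rabs r] and 1, so [k] divided by [q] lies below both moduli. *)
set (q := (Rabs r + 1)%R).
assert (Hq : (0 < q)%R) by (unfold q; pose proof (Rabs_pos r); lra).
assert (Hq' : (0 <= / q)%R) by (left; apply Rinv_0_lt_compat, Hq).
assert (Hk3 : k <= q *: vabs x).
{ apply (vle_trans Hk1), (vle_trans (vabsZ r x)), scal_le_scal;
    [unfold q; lra|apply vabs_ge0]. }
assert (Hk4 : k <= q *: vabs y).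
{ apply (vle_trans Hk2).
  replace (vabs y) with (1 *: vabs y) at 1 by vring.
  apply scal_le_scal;
    [unfold q; pose proof (Rabs_pos r); lra|apply vabs_ge0]. }
apply (scal_le0 (/ q)); [apply Rinv_0_lt_compat, Hq|].
apply H; [vle_by (vle_scal Hq' Hk3)|vle_by (vle_scal Hq' Hk4)].
Qed.

Lemma vdisj0l x : vdisj 0 x.
Proof.
apply vdisjP; intros k Hk _.
rewrite vabs_pos in Hk by apply vle_refl; exact Hk.
Qed.

Lemma vdisj_self x : vdisj x x -> x = 0.
Proof.
rewrite vdisjP; intros H.
specialize (H _ (vle_refl _ _) (vle_refl _ _)).
apply vle_antisym; [exact (vle_trans (le_vabs x) H)|].
vle_by (vle_trans (opp_le_vabs x) H).
Qed.

(** The element [- a] is at most [b], hence lies below both moduli. *)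
Lemma vdisj_sum_ge0 a b : vdisj a b -> 0 <= a + b -> 0 <= a.
Proof.
rewrite vdisjP; intros H Hab.
assert (H1 : - a <= 0).
{ apply H; [apply opp_le_vabs|].
  vle_by (leD Hab (le_vabs b)). }
vle_by H1.
Qed.

Lemma vdisj_nonneg x y : 0 <= x -> 0 <= y ->
  vdisj x y -> forall k, k <= x -> k <= y -> k <= 0.
Proof. intros Hx Hy; rewrite vdisjP, !vabs_pos by assumption; auto. Qed.

Lemma vdisj_vpos x y : vdisj x y -> vdisj (vpos x) (vpos y).
Proof.
apply vdisj_le; (rewrite vabs_pos by apply vpos_ge0); apply vpos_le_vabs.
Qed.

Lemma vdisj_vpos_opp x : vdisj (vpos x) (vpos (- x)).
Proof.
apply vdisjP; intros k.
rewrite !vabs_pos by apply vpos_ge0; intros H1 H2.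
assert (H : vpos (- x) <= vpos (- x) - k).
{ apply vpos_lub; [|vle_by H2].
  rewrite vposN; vle_by H1. }
vle_by H.
Qed.

Lemma vposD x y : vdisj x y -> vpos (x + y) = vpos x + vpos y.
Proof.
intros H; apply vle_antisym.
- apply vpos_lub; [exact (leD (vpos_ge x) (vpos_ge y))|].
  vle_by (leD (vpos_ge0 x) (vpos_ge0 y)).
(* The sums of positive and of negative parts are disjoint with difference [x + y]; the gap
   [vpos x + vpos y - vpos (x + y)] lies below both of them. *)
- assert (Hd : vdisj (vpos x + vpos y) (vpos (- x) + vpos (- y))).
  { apply vdisj_addl; apply vdisj_addr; try apply vdisj_vpos_opp;
      apply vdisj_vpos; apply vdisj_oppr; [|apply vdisj_sym]; exact H. }
  assert (Hk : vpos x + vpos y - vpos (x + y) <= 0).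
  { refine (vdisj_nonneg _ _ _ _ Hd _ _ _).
    - vle_by (leD (vpos_ge0 x) (vpos_ge0 y)).
    - vle_by (leD (vpos_ge0 (- x)) (vpos_ge0 (- y))).
    - vle_by (vpos_ge0 (x + y)).
    - apply (le_transfer (vpos_ge (x + y))).
      rewrite !vposN; vring. }
  vle_by Hk.
Qed.

(** A Riesz decomposition with canonical pieces. Disjointness enters because the excess of the two
    meets over [a] lies below both [c] and [d]. *)
Lemma meet_split a c d : 0 <= a -> 0 <= c -> 0 <= d ->
  a <= c + d -> vdisj c d -> a = (a ⊓ c) + (a ⊓ d).
Proof.
intros Ha Hc Hd H Hcd; apply vle_antisym.
- assert (H1 : a - (a ⊓ d) <= a ⊓ c).
  { apply vmeet_glb; [vle_by (vmeet_ge0 a d Ha Hd)|].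
    assert (H2 : a - c <= a ⊓ d).
    { apply vmeet_glb; [vle_by Hc|vle_by H]. }
    vle_by H2. }
  vle_by H1.
- assert (H1 : (a ⊓ c) + (a ⊓ d) - a <= 0).
  { apply (vdisj_nonneg c d Hc Hd Hcd).
    - vle_by (leD (vmeet_r _ a c) (vmeet_l _ a d)).
    - vle_by (leD (vmeet_l _ a c) (vmeet_r _ a d)). }
  vle_by H1.
Qed.

(** * Fragments *)

Lemma fragment0 e : fragment e 0.
Proof. apply vdisj0l. Qed.

Lemma fragment_sub e f : fragment e f -> fragment e (e - f).
Proof.
unfold fragment; intros H.
replace (e - (e - f)) with f by vring; apply vdisj_sym, H.
Qed.

(** A fragment has smaller modulus: positive parts add over disjoint sums, so those of [f] and [- f]
    are below those of [e] and [- e]. *)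
Lemma vdisj_fragment_decomp e f g : fragment e f -> vdisj e g -> vdisj f g.
Proof.
unfold fragment; intros H; apply vdisj_le; [|apply vle_refl].
assert (Hp : forall a b, vdisj a b -> vpos a <= vpos (a + b)).
{ intros a b Hab; rewrite (vposD _ _ Hab); vle_by (vpos_ge0 b). }
assert (He : e = f + (e - f)) by vring.
assert (He' : - e = - f + - (e - f)) by vring.
apply vabs_lub.
- apply (vle_trans (vpos_ge f)), (vle_trans (Hp _ _ H)).
  rewrite <- He; apply vpos_le_vabs.
- apply (vle_trans (vpos_ge (- f))).
  apply (vle_trans (Hp _ _ (vdisj_oppl _ _ (vdisj_oppr _ _ H)))).
  rewrite <- He'; apply vpos_opp_le_vabs.
Qed.


Lemma fragment_vdisj x y f g :
  vdisj x y -> fragment x f -> fragment y g -> vdisj f g.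
Proof.
intros H Hf Hg; apply (vdisj_fragment_decomp x); [exact Hf|].
apply vdisj_sym, (vdisj_fragment_decomp y); [exact Hg|].
apply vdisj_sym, H.
Qed.

Lemma fragmentD x y f g :
  vdisj x y -> fragment x f -> fragment y g -> fragment (x + y) (f + g).
Proof.
intros H Hf Hg; unfold fragment.
replace (x + y - (f + g)) with ((x - f) + (y - g)) by vring.
apply vdisj_addl; apply vdisj_addr; try assumption.
- apply (fragment_vdisj x y); auto using fragment_sub.
- apply (fragment_vdisj y x); auto using fragment_sub, vdisj_sym.
Qed.

(** The part of [h] under [x], with signs respected. When [h] is a fragment of a disjoint sum
    [x + y], it is the component of [h] inside [x]. *)
Definition vcut h x := (vpos h ⊓ vpos x) - (vpos (- h) ⊓ vpos (- x)).

Lemma vabs_vcut h x : vabs (vcut h x) <= vabs h.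
Proof.
unfold vcut; apply vabs_lub.
- apply (vle_trans (y := vpos h)); [|apply vpos_le_vabs].
  vle_by (leD (vmeet_l _ (vpos h) (vpos x))
    (vmeet_ge0 _ _ (vpos_ge0 (- h)) (vpos_ge0 (- x)))).
- apply (vle_trans (y := vpos (- h))); [|apply vpos_opp_le_vabs].
  vle_by (leD (vmeet_l _ (vpos (- h)) (vpos (- x)))
    (vmeet_ge0 _ _ (vpos_ge0 h) (vpos_ge0 x))).
Qed.

Lemma vcutC h x : vcut h x = vcut x h.
Proof.
unfold vcut; rewrite (vmeetC (vpos h)), (vmeetC (vpos (- h))); reflexivity.
Qed.

(** Comparing positive parts of the two disjoint decompositions gives [vpos h <= vpos x + vpos y],
    and likewise for negative parts; [meet_split] then applies to each sign. *)
Lemma vcut_split h w x y :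
  vdisj h w -> vdisj x y -> h + w = x + y -> vcut h x + vcut h y = h.
Proof.
intros Hhw Hxy E; unfold vcut.
assert (Hp : vpos h <= vpos x + vpos y).
{ rewrite <- (vposD _ _ Hxy), <- E, (vposD _ _ Hhw); vle_by (vpos_ge0 w). }
assert (Hn : vpos (- h) <= vpos (- x) + vpos (- y)).
{ assert (E' : - h + - w = - x + - y).
  { transitivity (- (h + w)); [|rewrite E]; vring. }
  rewrite <- vposD, <- E', vposD by (apply vdisj_oppl, vdisj_oppr; assumption).
  vle_by (vpos_ge0 (- w)). }
rewrite <- (vpos_sub_vpos_opp h) at 5.
rewrite (meet_split (vpos h) (vpos x) (vpos y)) at 3;
  auto using vpos_ge0, vdisj_vpos.
rewrite (meet_split (vpos (- h)) (vpos (- x)) (vpos (- y))) at 3;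
  auto using vpos_ge0, vdisj_vpos, vdisj_oppl, vdisj_oppr.
vring.
Qed.

(** Exchanging the roles of the two decompositions in [vcut_split] shows that the rest of [x] is
    [vcut w x], which is disjoint from [vcut h x] because [h] and [w] are disjoint. *)
Lemma fragment_vcut h w x y :
  vdisj h w -> vdisj x y -> h + w = x + y -> fragment x (vcut h x).
Proof.
intros Hhw Hxy E; unfold fragment.
replace (x - vcut h x) with (vcut w x).
- apply (vdisj_le h w); auto using vabs_vcut.
- pose proof (vcut_split x y h w Hxy Hhw (eq_sym E)) as H.
  rewrite <- H at 2; rewrite (vcutC x h), (vcutC x w); vring.
Qed.

(** This refinement makes the infimum formula for the meet of two operators superadditive on
    disjoint sums. *)
Lemma fragment_split x y h : vdisj x y -> fragment (x + y) h ->
  exists f g, fragment x f /\ fragment y g /\ h = f + g.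
Proof.
intros Hxy Hh.
assert (E : h + (x + y - h) = x + y) by vring.
assert (E' : h + (x + y - h) = y + x) by vring.
exists (vcut h x), (vcut h y); repeat split.
- exact (fragment_vcut _ _ _ _ Hh Hxy E).
- exact (fragment_vcut _ _ _ _ Hh (vdisj_sym _ _ Hxy) E').
- symmetry; exact (vcut_split _ _ _ _ Hh Hxy E).
Qed.

(** * Bands and band projections *)

(** For closure under suprema, [s] is split by sign. If [j] is below [vpos s] and [vabs w], then
    [vpos s - j] still bounds [D], so [j <= 0]. The negative part of [s] is dominated by that of any
    single member of [D]. *)
Lemma disj_compl_band (W : V -> Prop) : band (disj_compl W).
Proof.
split; [split; [|split; [|split]]|].
- intros w _; apply vdisj0l.
- intros x y Hx Hy w Hw; apply vdisj_addl; auto.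
- intros r x Hx w Hw; apply vdisj_scall; auto.
- intros x y Hx Hyx w Hw; apply (vdisj_le x w); auto using vle_refl.
- intros D s HD Hs w Hw; apply vdisjP; intros k Hk1 Hk2.
  destruct (classic (exists d, D d)) as [[d0 Hd0]|HDe].
  + assert (Hpos : forall j, j <= vpos s -> j <= vabs w -> j <= 0).
    { intros j Hj1 Hj2.
      assert (Hd : forall d, D d -> vpos d <= vpos s - j).
      { intros d Hd.
        assert (Hdw : vdisj (vpos d) w).
        { apply (vdisj_le d w); auto using vle_refl; [|apply HD; assumption].
          rewrite vabs_pos; auto using vpos_ge0, vpos_le_vabs. }
        assert (Hds : vpos d <= vpos s).
        { apply vpos_lub; [|apply vpos_ge0].
          apply (vle_trans (y := s)); [apply Hs, Hd|apply vpos_ge]. }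
        assert (H : j - (vpos s - vpos d) <= 0).
        { rewrite vdisjP in Hdw; apply Hdw.
          - rewrite vabs_pos by apply vpos_ge0; vle_by Hj1.
          - vle_by (leD Hj2 Hds). }
        vle_by H. }
      assert (H : vpos s <= vpos s - j).
      { apply vpos_lub.
        - apply Hs; intros d HDd.
          exact (vle_trans (vpos_ge d) (Hd d HDd)).
        - exact (vle_trans (vpos_ge0 d0) (Hd d0 Hd0)). }
      vle_by H. }
    assert (Hneg : vdisj (vpos (- s)) w).
    { apply (vdisj_le d0 w); auto using vle_refl; [|apply HD; assumption].
      rewrite vabs_pos by apply vpos_ge0.
      apply (vle_trans (y := vpos (- d0))); [|apply vpos_opp_le_vabs].
      apply vpos_lub; [|apply vpos_ge0].
      apply (vle_trans (y := - d0)); [|apply vpos_ge].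
      vle_by (proj1 Hs d0 Hd0). }
    assert (H : k - vpos (- s) <= 0).
    { apply Hpos.
      - vle_by (vle_trans Hk1 (vabs_split s)).
      - vle_by (leD Hk2 (vpos_ge0 (- s))). }
    rewrite vdisjP in Hneg; apply Hneg; [|exact Hk2].
    rewrite vabs_pos by apply vpos_ge0; vle_by H.
  + (* The supremum of the empty set is a least element. *)
    assert (H : s <= s - k).
    { apply Hs; intros d Hd; destruct HDe; exists d; exact Hd. }
    vle_by H.
Qed.

Section Projection.
Variables (B : V -> Prop) (rho : V -> V).
Hypotheses (HB : band B)
  (Hrho : forall x, B (rho x) /\ disj_compl B (x - rho x)).

(** Two candidates differ by an element of [B] that is disjoint from [B], hence from itself.
    Linearity of band projections is derived from this uniqueness. *)
Lemma proj_unique x z : B z -> disj_compl B (x - z) -> rho x = z.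
Proof.
intros Hz Hxz; destruct (Hrho x) as [H1 H2].
destruct HB as [(_ & HD & HZ & _) _].
assert (H3 : B (rho x - z)).
{ replace (rho x - z) with (rho x + (-1) *: z) by vring.
  apply HD; [exact H1|apply HZ, Hz]. }
assert (H4 : rho x - z = 0).
{ apply vdisj_self.
  replace (rho x - z) with ((x - z) + - (x - rho x)) at 1 by vring.
  apply vdisj_addl; [apply Hxz, H3|apply vdisj_oppl, H2, H3]. }
transitivity ((rho x - z) + z); [|rewrite H4]; vring.
Qed.

Lemma projD x y : rho (x + y) = rho x + rho y.
Proof.
destruct (Hrho x) as [H1 H2], (Hrho y) as [H3 H4].
destruct HB as [(_ & HD & _ & _) _].
apply proj_unique; [apply HD; assumption|].
replace (x + y - (rho x + rho y)) with ((x - rho x) + (y - rho y)) by vring.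
intros w Hw; apply vdisj_addl; auto.
Qed.

Lemma projZ r x : rho (r *: x) = r *: rho x.
Proof.
destruct (Hrho x) as [H1 H2].
destruct HB as [(_ & _ & HZ & _) _].
apply proj_unique; [apply HZ; assumption|].
replace (r *: x - r *: rho x) with (r *: (x - rho x)) by vring.
intros w Hw; apply vdisj_scall; auto.
Qed.

Lemma projN x : rho (- x) = - rho x.
Proof. rewrite !vopp_scal; apply projZ. Qed.

Lemma proj_ge0 x : 0 <= x -> 0 <= rho x.
Proof.
intros Hx; destruct (Hrho x) as [H1 H2].
apply (vdisj_sum_ge0 _ (x - rho x)).
- apply vdisj_sym, H2, H1.
- vle_by Hx.
Qed.

Lemma proj_le x : 0 <= x -> rho x <= x.
Proof.
intros Hx; destruct (Hrho x) as [H1 H2].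
assert (H : 0 <= x - rho x).
{ apply (vdisj_sum_ge0 _ (rho x)); [apply H2, H1|vle_by Hx]. }
vle_by H.
Qed.

Lemma proj_mono x y : x <= y -> rho x <= rho y.
Proof.
intros H; assert (H1 : 0 <= y - x) by vle_by H.
apply proj_ge0 in H1; rewrite projD, projN in H1; vle_by H1.
Qed.

End Projection.

(** * Consequences of Dedekind completeness: the Archimedean property and principal projections *)

Section DedekindComplete.
Hypothesis HV : dedekind_complete V.

Lemma inf_exists (D : V -> Prop) :
  (exists x, D x) -> (exists l, is_lb D l) -> exists i, is_inf D i.
Proof.
intros [x0 H0] [l Hl].
destruct (HV (is_lb D)) as [i Hi].
- exists l; exact Hl.
- exists x0; intros y Hy; apply Hy, H0.
- exists i; split.
  + intros x Hx; apply Hi; intros y Hy; apply Hy, Hx.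
  + intros y Hy; apply Hi, Hy.
Qed.

(** The positive multiples of [v] are bounded by [s]. Doubling maps this set to itself, so its
    supremum [m] satisfies [m <= (1 / 2) *: m]; hence [v <= m <= 0]. *)
Lemma archimedean s v : 
  (forall r, (0 < r)%R -> v <= r *: s) -> v <= 0.
Proof.
intros H.
destruct (HV (fun z => exists r, (0 < r)%R /\ z = r *: v)) as [m Hm].
- exists (1 *: v), 1%R; split; [lra|reflexivity].
- exists s; intros z (r & Hr & ->).
  assert (Hr' : (0 < / r)%R) by (apply Rinv_0_lt_compat, Hr).
  vle_by (vle_scal (Rlt_le _ _ Hr) (H _ Hr')).
- assert (H1 : m <= (1 / 2) *: m).
  { apply Hm; intros z (r & Hr & ->).
    assert (H2 : (2 * r) *: v <= m).
    { apply Hm; exists (2 * r)%R; split; [lra|reflexivity]. }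
    assert (H3 : (0 <= 1 / 2)%R) by lra.
    vle_by (vle_scal H3 H2). }
  assert (H2 : 1 *: v <= m).
  { apply Hm; exists 1%R; split; [lra|reflexivity]. }
  assert (H3 : (0 <= 2)%R) by lra.
  vle_by (leD H2 (vle_scal H3 H1)).
Qed.

(** For positive [u] and [x], the supremum of this set is the component of [x] in the principal band
    of [u]. *)
Definition truncations u x : V -> Prop :=
  fun z => exists r, (0 <= r)%R /\ z = x ⊓ (r *: u).

Lemma trunc_decomp u x : 0 <= u -> 0 <= x ->
  exists p, is_sup (truncations u x) p /\
    disj_compl (disj_compl (eq u)) p /\ disj_compl (eq u) (x - p).
Proof.
intros Hu Hx.
destruct (HV (truncations u x)) as [p Hp].
- exists (x ⊓ (0 *: u)), 0%R; split; [lra|reflexivity].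
- exists x; intros z (r & _ & ->); apply vmeet_l.
- assert (Hpx : p <= x).
  { apply Hp; intros z (r & _ & ->); apply vmeet_l. }
  assert (Hr : forall r, (0 <= r)%R -> x ⊓ (r *: u) <= p).
  { intros r Hr; apply Hp; exists r; split; auto. }
  assert (Hp0 : 0 <= p).
  { apply (vle_trans (y := x ⊓ (0 *: u))).
    - apply vmeet_ge0; [exact Hx|apply scal_ge0; [lra|exact Hu]].
    - apply Hr; lra. }
  exists p; split; [exact Hp|split].
  + apply (proj2 (disj_compl_band _) (truncations u x)); [|exact Hp].
    intros z (r & Hr0 & ->) y Hy.
    apply (vdisj_le (r *: u) y).
    * rewrite !vabs_pos; auto using vmeet_r, vmeet_ge0, scal_ge0.
    * apply vle_refl.
    * apply vdisj_scall, vdisj_sym, Hy; reflexivity.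
  + intros u' <-; apply vdisjP; intros k.
    rewrite !vabs_pos; [|assumption|vle_by Hpx]; intros Hk1 Hk2.
    (* Adding [k] to the truncation at [r] stays below the truncation at [r + 1], so [p - k] is
       again an upper bound. *)
    assert (H : p <= p - k).
    { apply Hp; intros z (r & Hr0 & ->).
      assert (H1 : (x ⊓ (r *: u)) + k <= x ⊓ ((r + 1) *: u)).
      { apply vmeet_glb.
        - vle_by (leD (Hr r Hr0) Hk1).
        - vle_by (leD (vmeet_r _ x (r *: u)) Hk2). }
      assert (H2 : (0 <= r + 1)%R) by lra.
      vle_by (vle_trans H1 (Hr _ H2)). }
    vle_by H.
Qed.

Lemma principal_proj u : 0 <= u -> exists p : V -> V,
  (forall x, disj_compl (disj_compl (eq u)) (p x) /\
    disj_compl (eq u) (x - p x)) /\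
  forall x, 0 <= x -> is_sup (truncations u x) (p x).
Proof.
intros Hu.
assert (H : forall x, exists p,
  (disj_compl (disj_compl (eq u)) p /\ disj_compl (eq u) (x - p)) /\
  (0 <= x -> is_sup (truncations u x) p)).
{ intros x.
  destruct (trunc_decomp u (vpos x) Hu (vpos_ge0 x)) as (p & Hp1 & Hp2 & Hp3).
  destruct (trunc_decomp u (vpos (- x)) Hu (vpos_ge0 _)) as (q & Hq1 & Hq2 & Hq3).
  (* At positive [x] the supremum itself is chosen, which keeps the truncation formula available;
     elsewhere the components of the positive and negative parts are subtracted. *)
  destruct (classic (0 <= x)) as [Hx|Hx].
  { destruct (trunc_decomp u x Hu Hx) as (r & Hr1 & Hr2 & Hr3).
    exists r; auto. }
  exists (p - q); split; [|intros Hx'; destruct (Hx Hx')].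
  split.
  - intros w Hw; apply vdisj_addl; [auto|apply vdisj_oppl; auto].
  - rewrite <- (vpos_sub_vpos_opp x) at 1.
    replace (vpos x - vpos (- x) - (p - q))
      with ((vpos x - p) + - (vpos (- x) - q)) by vring.
    intros w Hw; apply vdisj_addl; [auto|apply vdisj_oppl; auto]. }
destruct (functional_choice _ H) as [p Hp].
exists p; split; intros x; apply Hp.
Qed.

End DedekindComplete.
End VectorLatticeTheory.

Arguments inf_exists {V}.
Arguments archimedean {V}.

(** * Orthogonally additive operators *)

Definition op_scal {E F : VL} (r : R) (S : E -> F) : E -> F :=
  fun e => (r *: S e)%V.

Ltac op_vle_by H :=
  apply (le_transfer H); unfold op_add, op_opp, op_scal; vring.

Section OperatorTheory.
Variables E F : VL.
Hypothesis HF : dedekind_complete F.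
Local Open Scope vl_scope.
Implicit Types S T K P M Q X Y : E -> F.
Implicit Types e f g h : E.

Lemma uryson_add S T : uryson S -> uryson T -> uryson (op_add E F S T).
Proof.
intros [HS1 HS2] [HT1 HT2]; split.
- intros x y Hxy; unfold op_add; rewrite HS1, HT1 by assumption; vring.
- intros a b; destruct (HS2 a b) as (c & d & H), (HT2 a b) as (c' & d' & H').
  exists (c + c'), (d + d'); intros x Hax Hxb.
  destruct (H x Hax Hxb), (H' x Hax Hxb); split; apply leD; assumption.
Qed.

Lemma uryson_opp S : uryson S -> uryson (op_opp E F S).
Proof.
intros [HS1 HS2]; split.
- intros x y Hxy; unfold op_opp; rewrite HS1 by assumption; vring.
- intros a b; destruct (HS2 a b) as (c & d & H).
  exists (- d), (- c); intros x Hax Hxb.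
  destruct (H x Hax Hxb) as [H1 H2]; split; unfold op_opp;
    [op_vle_by H2|op_vle_by H1].
Qed.

Lemma uryson_scal_pos r S : (0 <= r)%R -> uryson S -> uryson (op_scal r S).
Proof.
intros Hr [HS1 HS2]; split.
- intros x y Hxy; unfold op_scal; rewrite HS1 by assumption; vring.
- intros a b; destruct (HS2 a b) as (c & d & H).
  exists (r *: c), (r *: d); intros x Hax Hxb.
  destruct (H x Hax Hxb); split; apply vle_scal; assumption.
Qed.

Lemma positive_scal r S :
  (0 <= r)%R -> positive_op S -> positive_op (op_scal r S).
Proof. intros Hr HS e; apply scal_ge0; auto. Qed.

Lemma uryson_between S T :
  orth_additive E F S -> positive_op S -> op_le S T -> uryson T -> uryson S.
Proof.
intros HS HSp HST [_ HT]; split; [exact HS|].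
intros a b; destruct (HT a b) as (c & d & H).
exists 0, d; intros x Hax Hxb; split; [apply HSp|].
apply (vle_trans (HST x)), H; assumption.
Qed.

Lemma orth_additive_fragment S e f :
  orth_additive E F S -> fragment e f -> S e = S f + S (e - f).
Proof.
intros HS Hf; rewrite <- HS by exact Hf; f_equal; vring.
Qed.

Lemma orth_additive0 S : orth_additive E F S -> S 0 = 0.
Proof.
intros HS; pose proof (orth_additive_fragment S 0 0 HS (fragment0 E 0)) as H.
replace (0 - 0 : E) with (0 : E) in H by vring.
apply (vadd_cancel _ _ _ (S 0)); rewrite <- H; vring.
Qed.

Lemma fragment_le S e f : orth_additive E F S -> positive_op S ->
  fragment e f -> S f <= S e.
Proof.
intros HS HSp Hf; rewrite (orth_additive_fragment S e f HS Hf).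
op_vle_by (HSp (e - f)).
Qed.

(** * Meets of positive abstract Uryson operators *)

Definition meet_values T S e : F -> Prop :=
  fun z => exists f, fragment e f /\ z = T f + S (e - f).

(** Bundles the universal property, used to compare truncations, with the pointwise formula, used to
    estimate the inner suprema. *)
Definition op_meet T S M : Prop :=
  uryson M /\ positive_op M /\ U_glb E F T S M /\
  forall e, is_inf (meet_values T S e) (M e).

Lemma op_meet_l T S M : op_meet T S M -> op_le M T.
Proof. intros (_ & _ & (_ & H & _) & _); exact H. Qed.

Lemma op_meet_r T S M : op_meet T S M -> op_le M S.
Proof. intros (_ & _ & (_ & _ & H & _) & _); exact H. Qed.

Lemma op_meet_glb T S M K :
  op_meet T S M -> uryson K -> op_le K T -> op_le K S -> op_le K M.
Proof. intros (_ & _ & (_ & _ & _ & H) & _); apply H. Qed.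

Lemma op_meet_exists T S :
  uryson T -> positive_op T -> uryson S -> positive_op S ->
  exists M, op_meet T S M.
Proof.
intros HT HTp HS HSp.
assert (H : forall e, exists z, is_inf (meet_values T S e) z).
{ intros e; apply (inf_exists HF).
  - exists (T 0 + S (e - 0)), 0; split; [apply fragment0|reflexivity].
  - exists 0; intros z (f & _ & ->); op_vle_by (leD (HTp f) (HSp (e - f))). }
destruct (functional_choice _ H) as [M HM].
assert (HMle : forall e f, fragment e f -> M e <= T f + S (e - f)).
{ intros e f Hf; apply HM; exists f; auto. }
assert (HMT : op_le M T).
{ intros e; apply (le_transfer (HMle e (e - 0) (fragment_sub _ _ _ (fragment0 _ e)))).
  replace (e - (e - 0)) with (0 : E) by vring.
  replace (e - 0) with e by vring.
  rewrite (orth_additive0 S) by apply HS; vring. }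
assert (HMS : op_le M S).
{ intros e; apply (le_transfer (HMle e 0 (fragment0 _ e))).
  replace (e - 0) with e by vring.
  rewrite (orth_additive0 T) by apply HT; vring. }
assert (HMp : positive_op M).
{ intros e; apply HM; intros z (f & _ & ->).
  op_vle_by (leD (HTp f) (HSp (e - f))). }
assert (HMa : orth_additive E F M).
{ intros x y Hxy.
  assert (Hval : forall f g, fragment x f -> fragment y g ->
    T (f + g) + S (x + y - (f + g)) =
    (T f + S (x - f)) + (T g + S (y - g))).
  { intros f g Hf Hg.
    rewrite (proj1 HT) by exact (fragment_vdisj _ _ _ _ _ Hxy Hf Hg).
    replace (x + y - (f + g)) with ((x - f) + (y - g)) by vring.
    rewrite (proj1 HS); [vring|].
    exact (fragment_vdisj _ _ _ _ _ Hxy (fragment_sub _ _ _ Hf)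
      (fragment_sub _ _ _ Hg)). }
  (* For [<=], infima are taken over fragments of [y] and then of [x]; for the converse, each
     fragment of [x + y] is split by [fragment_split]. *)
  apply vle_antisym.
  - assert (H1 : M (x + y) - M y <= M x).
    { apply HM; intros z (f & Hf & ->).
      assert (H2 : M (x + y) - (T f + S (x - f)) <= M y).
      { apply HM; intros z (g & Hg & ->).
        pose proof (HMle _ _ (fragmentD _ _ _ _ _ Hxy Hf Hg)) as H2.
        rewrite Hval in H2 by assumption; op_vle_by H2. }
      op_vle_by H2. }
    op_vle_by H1.
  - apply HM; intros z (h & Hh & ->).
    destruct (fragment_split _ _ _ _ Hxy Hh) as (f & g & Hf & Hg & ->).
    rewrite Hval by assumption.
    exact (leD (HMle _ _ Hf) (HMle _ _ Hg)). }
assert (HMu : uryson M) by exact (uryson_between M T HMa HMp HMT HT).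
exists M; repeat split; try assumption; try apply HMu; try apply HM.
intros K HK HKT HKS e; apply HM; intros z (f & Hf & ->).
rewrite (orth_additive_fragment K e f (proj1 HK) Hf).
exact (leD (HKT f) (HKS _)).
Qed.

Lemma uryson_sub S T :
  uryson S -> uryson T -> uryson (op_add E F S (op_opp E F T)).
Proof. intros HS HT; apply uryson_add, uryson_opp; assumption. Qed.

(* Disjointness of positive operators, without mentioning moduli. *)
Definition op_pdisj S T : Prop :=
  forall K, uryson K -> op_le K S -> op_le K T -> forall e, K e <= 0.

Lemma op_pdisj_sym S T : op_pdisj S T -> op_pdisj T S.
Proof. intros H K HK H1 H2; apply H; assumption. Qed.

Lemma op_pdisj_add S S' T :
  uryson S' -> positive_op S' ->
  op_pdisj S T -> op_pdisj S' T -> op_pdisj (op_add E F S S') T.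
Proof.
intros HS' HS'p H H' K HK HKS HKT.
apply H'; try assumption; intros e.
(* As for elements: [K - S'] is below both [S] and [T], which gives [K] below [S']. *)
assert (H1 : op_add E F K (op_opp E F S') e <= 0).
{ apply H; [apply uryson_sub; assumption| |]; intros x;
    unfold op_add, op_opp.
  - op_vle_by (HKS x).
  - op_vle_by (leD (HKT x) (HS'p x)). }
op_vle_by H1.
Qed.

Lemma op_pdisj_scal r S T : (0 <= r)%R -> positive_op S ->
  positive_op T -> op_pdisj S T -> op_pdisj (op_scal r S) T.
Proof.
intros Hr HS HT H K HK HKS HKT e.
(* [r + 1] dominates both [r] and 1, so dividing [K] by it brings [K] below [S] and [T]. *)
assert (Hq : (0 < / (r + 1))%R) by (apply Rinv_0_lt_compat; lra).
apply (scal_le0 _ (/ (r + 1)) _ Hq).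
apply (H (op_scal (/ (r + 1)) K)).
- apply uryson_scal_pos; [lra|exact HK].
- intros x; unfold op_scal in *.
  op_vle_by (vle_scal (Rlt_le _ _ Hq) (leD (HKS x) (HS x))).
- intros x; unfold op_scal in *.
  op_vle_by (vle_scal (Rlt_le _ _ Hq) (leD (HKT x) (scal_ge0 _ r _ Hr (HT x)))).
Qed.

(** * Moduli and disjointness of abstract Uryson operators *)

Lemma U_lub_modulus_pos S : uryson S -> positive_op S ->
  U_lub E F S (op_opp E F S) S.
Proof.
intros HS HSp; repeat split; try apply HS.
- intros e; apply vle_refl.
- intros e; unfold op_opp; op_vle_by (leD (HSp e) (HSp e)).
- intros K _ H _; exact H.
Qed.

Lemma modulus_ge0 S a : U_lub E F S (op_opp E F S) a -> positive_op a.
Proof.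
intros (_ & H1 & H2 & _) e.
assert (H : (0 <= 1 / 2)%R) by lra.
specialize (H1 e); specialize (H2 e); unfold op_opp in H2.
op_vle_by (vle_scal H (leD H1 H2)).
Qed.

Lemma U_disj_sym S T : U_disj E F S T -> U_disj E F T S.
Proof.
intros (a & b & Ha & Hb & Hu & H1 & H2 & H3).
exists b, a; repeat split; try assumption; try apply Ha; try apply Hb; try apply Hu.
intros K HK HKb HKa; apply H3; assumption.
Qed.

(** [U_disj] supplies some moduli only. Any others, being least, lie below these, so the conclusion
    transfers without equality of functions. *)
Lemma U_disj_pdisj S T a b : U_disj E F S T ->
  U_lub E F S (op_opp E F S) a -> U_lub E F T (op_opp E F T) b -> op_pdisj a b.
Proof.
intros (a' & b' & Ha' & Hb' & H) Ha Hb K HK HKa HKb.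
apply H; [exact HK| |]; intros e.
- apply (vle_trans (HKa e)), Ha; apply Ha'.
- apply (vle_trans (HKb e)), Hb; apply Hb'.
Qed.

Lemma pdisj_U_disj S T a b :
  U_lub E F S (op_opp E F S) a -> U_lub E F T (op_opp E F T) b ->
  op_pdisj a b -> U_disj E F S T.
Proof.
intros Ha Hb H; exists a, b; split; [exact Ha|split; [exact Hb|]].
repeat split.
- intros x y _; unfold op_zero; vring.
- intros x y; exists 0, 0; intros; split; apply vle_refl.
- exact (modulus_ge0 _ _ Ha).
- exact (modulus_ge0 _ _ Hb).
- exact H.
Qed.

Lemma pdisj_positive S T :
  uryson S -> positive_op S -> uryson T -> positive_op T ->
  op_pdisj S T <-> U_disj E F S T.
Proof.
intros HS HSp HT HTp; split.
- apply pdisj_U_disj; apply U_lub_modulus_pos; assumption.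
- intros H; apply (U_disj_pdisj S T); auto using U_lub_modulus_pos.
Qed.

(** * The component of [T] in the band generated by [A] *)

Section Component.
Variables (A : (E -> F) -> Prop) (T : E -> F).
Hypotheses (HA : forall S, A S -> uryson S /\ positive_op S)
  (HAne : exists S0, A S0) (HAinc : increasing_set A)
  (HTu : uryson T) (HTp : positive_op T).

Definition truncation_values e : F -> Prop :=
  fun z => exists r S M,
    (0 <= r)%R /\ A S /\ op_meet T (op_scal r S) M /\ z = M e.

Lemma truncation_exists r S :
  (0 <= r)%R -> A S -> exists M, op_meet T (op_scal r S) M.
Proof.
intros Hr HS; destruct (HA S HS).
apply op_meet_exists; auto using uryson_scal_pos, positive_scal.
Qed.

(** For [Q] in [A] above [S] and [S'], the multiple of [Q] by [r + r'] dominates both scaled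
    operators. *)
Lemma truncation_directed r S M r' S' M' :
  (0 <= r)%R -> A S -> op_meet T (op_scal r S) M ->
  (0 <= r')%R -> A S' -> op_meet T (op_scal r' S') M' ->
  exists q Q N, (0 <= q)%R /\ A Q /\ op_meet T (op_scal q Q) N /\
    op_le M N /\ op_le M' N.
Proof.
intros Hr HS HM Hr' HS' HM'.
destruct (HAinc S S' HS HS') as (Q & HQ & HSQ & HSQ').
assert (Hq : (0 <= r + r')%R) by lra.
destruct (truncation_exists _ _ Hq HQ) as [N HN].
assert (H : forall q S1 M1, (0 <= q <= r + r')%R -> op_le S1 Q ->
  op_meet T (op_scal q S1) M1 -> op_le M1 N).
{ intros q S1 M1 Hqr HSQ1 HM1.
  apply (op_meet_glb _ _ _ _ HN); [apply HM1|exact (op_meet_l _ _ _ HM1)|].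
  intros e; apply (vle_trans (op_meet_r _ _ _ HM1 e)).
  apply (vle_trans (vle_scal (proj1 Hqr) (HSQ1 e))).
  apply scal_le_scal; [apply Hqr|apply HA, HQ]. }
exists (r + r')%R, Q, N; split; [exact Hq|split; [exact HQ|split; [exact HN|]]].
split; [apply (H r S)|apply (H r' S')]; auto; lra.
Qed.

Lemma component_exists : exists P, uryson P /\ positive_op P /\
  op_le P T /\ forall e, is_sup (truncation_values e) (P e).
Proof.
destruct HAne as [S0 HS0].
(* One concrete truncation shows that the value sets are nonempty and that [P] is positive. *)
destruct (truncation_exists 0 S0 (Rle_refl 0) HS0) as [M0 HM0].
assert (HT : forall e, is_ub (truncation_values e) (T e)).
{ intros e z (r & S & M & _ & _ & HM & ->); exact (op_meet_l _ _ _ HM e). }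
assert (H : forall e, exists z, is_sup (truncation_values e) z).
{ intros e; apply HF; [|exists (T e); apply HT].
  exists (M0 e), 0%R, S0, M0; split; [lra|auto]. }
destruct (functional_choice _ H) as [P HP].
assert (HPT : op_le P T) by (intros e; apply HP; apply HT).
assert (HMP : forall r S M, (0 <= r)%R -> A S ->
  op_meet T (op_scal r S) M -> op_le M P).
{ intros r S M Hr HS HM e; apply HP; exists r, S, M; auto. }
assert (HPp : positive_op P).
{ intros e; apply (vle_trans (y := M0 e)); [apply (proj1 (proj2 HM0))|].
  apply (HMP 0%R S0); auto using Rle_refl. }
exists P; split; [|auto].
apply (uryson_between P T); auto.
intros x y Hxy; apply vle_antisym.
- apply HP; intros z (r & S & M & Hr & HS & HM & ->).
  rewrite (proj1 (proj1 HM)) by exact Hxy.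
  apply leD; apply (HMP r S); assumption.
(* Two truncations, one evaluated at [x] and the other at [y], are replaced by a common larger one,
   which is additive on [x + y]. *)
- assert (H1 : P x <= P (x + y) - P y).
  { apply HP; intros z (r & S & M & Hr & HS & HM & ->).
    assert (H2 : P y <= P (x + y) - M x).
    { apply HP; intros z (r' & S' & M' & Hr' & HS' & HM' & ->).
      destruct (truncation_directed _ _ _ _ _ _ Hr HS HM Hr' HS' HM')
        as (q & Q & N & Hq & HQ & HN & H1 & H2).
      pose proof (HMP _ _ _ Hq HQ HN (x + y)) as H3.
      rewrite (proj1 (proj1 HN)) in H3 by exact Hxy.
      op_vle_by (vle_trans (leD (H1 x) (H2 y)) H3). }
    op_vle_by H2. }
  op_vle_by H1.
Qed.

Lemma component_is_sigma P : uryson P -> positive_op P -> op_le P T ->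
  (forall e, is_sup (truncation_values e) (P e)) ->
  is_sigma A T (fun e => T e - P e).
Proof.
intros HPu HPp HPT HP.
assert (HMP : forall r S M, (0 <= r)%R -> A S ->
  op_meet T (op_scal r S) M -> op_le M P).
{ intros r S M Hr HS HM e; apply HP; exists r, S, M; auto. }
assert (Hu : uryson (fun e => T e - P e)) by exact (uryson_sub T P HTu HPu).
assert (Hp : positive_op (fun e => T e - P e)).
{ intros e; op_vle_by (HPT e). }
exists P; split; [|split].
- split; [exact HPu|].
  (* The modulus [a] of [X] is extracted from the disjointness of [X] with one member of [A]. *)
  intros X [HX HXA]; destruct HAne as [S0 HS0].
  destruct (HXA S0 HS0) as (a & _ & Ha & _).
  apply (pdisj_U_disj P X P a); auto using U_lub_modulus_pos.
  intros K HK HKP HKa e.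
  assert (H : P e <= P e - K e).
  { apply HP; intros z (r & S & M & Hr & HS & HM & ->).
    destruct (HA S HS) as [HSu HSp].
    assert (HaS : op_pdisj (op_scal r S) a).
    { apply op_pdisj_scal; auto; [exact (modulus_ge0 _ _ Ha)|].
      apply op_pdisj_sym, (U_disj_pdisj X S); auto using U_lub_modulus_pos. }
    (* [K - (P - M)] lies below [M], hence below the scaled [S], and also below [a]; these two are
       disjoint. *)
    assert (H : K e - (P e - M e) <= 0).
    { apply (HaS (fun x => K x - (P x - M x))).
      - exact (uryson_sub K (fun x => P x - M x) HK
          (uryson_sub P M HPu (proj1 HM))).
      - intros x.
        pose proof (op_meet_r _ _ _ HM x) as H1.
        op_vle_by (leD (HKP x) H1).
      - intros x; op_vle_by (leD (HKa x) (HMP r S M Hr HS HM x)). }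
    op_vle_by H. }
  op_vle_by H.
- split; [exact Hu|].
  (* It suffices that [T - P] is disjoint from [A], since [Q] is disjoint from everything with that
     property. *)
  intros Q [_ HQ]; apply U_disj_sym, HQ; split; [exact Hu|].
  intros S HS; destruct (HA S HS) as [HSu HSp].
  apply pdisj_positive; try assumption.
  intros K HK HKT HKS e.
  assert (H : P e <= P e - K e).
  { apply HP; intros z (r & S' & M & Hr & HS' & HM & ->).
    destruct (HAinc S S' HS HS') as (Q' & HQ' & HSQ & HSQ').
    assert (Hr1 : (0 <= r + 1)%R) by lra.
    destruct (truncation_exists _ _ Hr1 HQ') as [N HN].
    assert (H : (fun x => M x + K x) e <= N e).
    { refine (op_meet_glb _ _ _ (fun x => M x + K x) HN _ _ _ e).
      - exact (uryson_add M K (proj1 HM) HK).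
      - intros x; op_vle_by (leD (HMP r S' M Hr HS' HM x) (HKT x)).
      - intros x; unfold op_scal.
        pose proof (op_meet_r _ _ _ HM x) as H1.
        unfold op_scal in H1.
        op_vle_by (leD (leD H1 (vle_scal Hr (HSQ' x)))
          (vle_trans (HKS x) (HSQ x))). }
    op_vle_by (vle_trans H (HMP _ _ _ Hr1 HQ' HN e)). }
  op_vle_by H.
- intros e; vring.
Qed.

(** The difference [Sg' - Sg] equals [P - P']. It is thus below the sum of the moduli of [Sg'] and
    [Sg] and below that of [P] and [P'], which are disjoint. *)
Lemma sigma_unique Sg Sg' :
  is_sigma A T Sg -> is_sigma A T Sg' -> forall e, Sg e = Sg' e.
Proof.
assert (Hle : forall Sg Sg', is_sigma A T Sg -> is_sigma A T Sg' ->
  forall e, Sg' e <= Sg e).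
{ clear Sg Sg'; intros Sg Sg' (P & HP & HSg & HT) (P' & HP' & HSg' & HT') e.
  destruct (proj2 HSg P HP) as (a & b & Ha & Hb & _).
  destruct (proj2 HSg' P' HP') as (a' & b' & Ha' & Hb' & _).
  assert (H : op_pdisj (op_add E F a' a) (op_add E F b b')).
  { apply op_pdisj_add; [apply Ha|exact (modulus_ge0 _ _ Ha)| |];
      apply op_pdisj_sym, op_pdisj_add;
      try (apply Hb'); try exact (modulus_ge0 _ _ Hb');
      apply op_pdisj_sym.
    - exact (U_disj_pdisj _ _ _ _ (proj2 HSg' P HP) Ha' Hb).
    - exact (U_disj_pdisj _ _ _ _ (proj2 HSg' P' HP') Ha' Hb').
    - exact (U_disj_pdisj _ _ _ _ (proj2 HSg P HP) Ha Hb).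
    - exact (U_disj_pdisj _ _ _ _ (proj2 HSg P' HP') Ha Hb'). }
  assert (H1 : (fun x => Sg' x - Sg x) e <= 0).
  { refine (H (fun x => Sg' x - Sg x) _ _ _ e).
    - exact (uryson_sub Sg' Sg (proj1 HSg') (proj1 HSg)).
    - intros x; unfold op_add.
      pose proof (proj1 (proj2 Ha') x) as H1.
      pose proof (proj1 (proj2 (proj2 Ha)) x) as H2.
      op_vle_by (leD H1 H2).
    - intros x; unfold op_add.
      pose proof (proj1 (proj2 Hb) x) as H1.
      pose proof (proj1 (proj2 (proj2 Hb')) x) as H2.
      apply (le_transfer (leD H1 H2)).
      assert (H3 : Sg' x = P x + Sg x - P' x).
      { rewrite <- HT, HT'; vring. }
      rewrite H3; unfold op_opp; vring. }
  op_vle_by H1. }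
intros H H' e; apply vle_antisym; apply Hle; assumption.
Qed.

(** * Estimates for the inner suprema *)

Lemma inner_set_bounded S eps e : is_ub (inner_set E F T S eps e) (T e).
Proof.
intros z (f & rho & Hf & (B & HB & Hrho) & _ & ->).
apply (vle_trans (y := T f)).
- apply (proj_le F B rho Hrho); apply HTp.
- apply fragment_le; auto; apply HTu.
Qed.

Lemma inner_set_nonempty S eps e : A S -> (0 < eps)%R ->
  inner_set E F T S eps e 0.
Proof.
intros HS He; exists 0, (fun x => x); repeat split.
- apply fragment0.
- exists (fun _ => True); split.
  + repeat split; auto.
  + intros x; split; [exact I|].
    intros w _; replace (x - x) with (0 : F) by vring; apply vdisj0l.
- rewrite (orth_additive0 S) by apply (HA S HS).
  apply scal_ge0; [lra|apply (HA S HS)].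
- rewrite (orth_additive0 T) by apply HTu; reflexivity.
Qed.

(* Truncating by [r S] with [r eps] small bounds the inner supremum, since
   rho (T f) <= rho (T f - r S f) + r eps S e. *)
Lemma inner_sup_le r S M eps e y :
  (0 <= r)%R -> A S -> op_meet T (op_scal r S) M ->
  is_sup (inner_set E F T S eps e) y ->
  y <= T e - M e + (r * eps) *: S e.
Proof.
intros Hr HS HM Hy; apply Hy.
intros z (f & rho & Hf & (B & HB & Hrho) & Hle & ->).
assert (H : T f - r *: S f <= T e - M e).
{ assert (H : M e <= T (e - f) + op_scal r S (e - (e - f))).
  (* Taking the complementary fragment in the infimum makes [S] act on [f]. *)
  { apply HM; exists (e - f); split; [apply fragment_sub, Hf|reflexivity]. }
  replace (e - (e - f)) with f in H by vring.
  apply (le_transfer H).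
  rewrite (orth_additive_fragment T e f (proj1 HTu) Hf).
  unfold op_scal; vring. }
assert (HG : 0 <= T e - M e).
{ pose proof (op_meet_l _ _ _ HM e) as H1; op_vle_by H1. }
apply (proj_mono F B rho HB Hrho) in H.
rewrite (projD F B rho HB Hrho), (projN F B rho HB Hrho),
  (projZ F B rho HB Hrho) in H.
op_vle_by (leD (leD H (proj_le F B rho Hrho _ HG)) (vle_scal Hr Hle)).
Qed.

Lemma sigma_le_inner_sup P S eps e y :
  (forall e, is_sup (truncation_values e) (P e)) ->
  A S -> (0 < eps)%R -> is_sup (inner_set E F T S eps e) y ->
  T e - P e <= y.
Proof.
intros HP HS Heps Hy.
destruct (HA S HS) as [HSu HSp].
destruct (principal_proj F HF (S e) (HSp e)) as (p & Hp & Hpsup).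
pose proof (disj_compl_band F (disj_compl (eq (S e)))) as HBp.
assert (Hkey : forall k, (0 <= k)%R ->
  T e - P e <= y + p (vpos F (T e - k *: S e))).
(* The truncation level is chosen so that [r * eps = k]. *)
{ intros k Hk; set (r := (k / eps)%R).
  assert (Hr : (0 <= r)%R).
  { apply Rmult_le_pos; [exact Hk|left; apply Rinv_0_lt_compat, Heps]. }
  assert (Hk' : k = (r * eps)%R) by (unfold r; field; lra).
  destruct (truncation_exists r S Hr HS) as [M HM].
  assert (HMP : M e <= P e) by (apply HP; exists r, S, M; auto).
  assert (H : T e - (y + p (vpos F (T e - k *: S e))) <= M e).
  { apply HM; intros z (g & Hg & ->).
    assert (Hf : fragment e (e - g)) by apply fragment_sub, Hg.
    assert (HTg : T g = T e - T (e - g)).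
    { rewrite (orth_additive_fragment T e g (proj1 HTu) Hg) at 1; vring. }
    rewrite HTg.
    set (f := e - g) in *; unfold op_scal.
    set (w := S f - eps *: S e).
    destruct (principal_proj F HF (vpos F w) (vpos_ge0 F w)) as (q & Hq & Hqsup).
    (* [q] projects onto the band generated by the positive part of [w], and [rho] onto its
       complement [C]; [rho w] is then minus the negative part of [w], which makes [rho] admissible
       in the inner set. *)
    set (C := disj_compl (eq (vpos F w))).
    pose (rho := fun x : F => x - q x).
    assert (HC : band C) by apply disj_compl_band.
    assert (Hrho : forall x, C (rho x) /\ disj_compl C (x - rho x)).
    { intros x; unfold rho; split; [apply Hq|].
      replace (x - (x - q x)) with (q x) by vring; apply Hq. }
    assert (Hrpos : rho (vpos F w) = 0).
    { apply (proj_unique F C rho HC Hrho); [intros v _; apply vdisj0l|].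
      replace (vpos F w - 0) with (vpos F w) by vring.
      intros v Hv; apply vdisj_sym, Hv; reflexivity. }
    assert (Hrneg : rho (vpos F (- w)) = vpos F (- w)).
    { apply (proj_unique F C rho HC Hrho).
      - intros v <-; apply vdisj_sym, vdisj_vpos_opp.
      - replace (vpos F (- w) - vpos F (- w)) with (0 : F) by vring.
        intros v _; apply vdisj0l. }
    assert (Hrw : rho w = - vpos F (- w)).
    { rewrite <- (vpos_sub_vpos_opp F w) at 1.
      rewrite (projD F C rho HC Hrho), (projN F C rho HC Hrho), Hrpos, Hrneg.
      vring. }
    assert (Hrw' : rho w = rho (S f) - eps *: rho (S e)).
    { unfold w; rewrite (projD F C rho HC Hrho), (projN F C rho HC Hrho),
        (projZ F C rho HC Hrho); reflexivity. }
    assert (F1 : rho (T f) <= y).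
    { apply Hy; exists f, rho; split; [exact Hf|split; [exists C; auto|]].
      split; [|reflexivity].
      assert (H1 : rho w <= 0) by (rewrite Hrw; op_vle_by (vpos_ge0 F (- w))).
      rewrite Hrw' in H1.
      op_vle_by (leD H1 (vle_scal (Rlt_le _ _ Heps)
        (proj_le F C rho Hrho (S e) (HSp e)))). }
    assert (F2 : 0 <= rho (S f)) by (apply (proj_ge0 F C rho Hrho), HSp).
    assert (F3 : 0 <= S f - rho (S f) - eps *: (S e - rho (S e))).
    { assert (H1 : 0 <= w - rho w).
      { rewrite Hrw, <- (vpos_sub_vpos_opp F w) at 1.
        op_vle_by (vpos_ge0 F w). }
      rewrite Hrw' in H1; unfold w in H1; op_vle_by H1. }
    assert (Hqr : forall x x', x <= x' -> x - rho x <= x' - rho x').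
    { intros x x' Hx; assert (H1 : 0 <= x' - x) by op_vle_by Hx.
      apply (proj_le F C rho Hrho) in H1.
      rewrite (projD F C rho HC Hrho), (projN F C rho HC Hrho) in H1.
      op_vle_by H1. }
    set (v := vpos F (T e - k *: S e)).
    (* The positive part of [w] is below [S f], hence below [S e], so truncations of [v] by it are
       below those by [S e]. *)
    assert (F4 : v - rho v <= p v).
    { replace (v - rho v) with (q v) by (unfold rho; vring).
      apply (Hqsup v (vpos_ge0 F _)); intros z (t & Ht & ->).
      apply (vle_trans (y := v ⊓ (t *: S e))).
      - apply vmeet_glb; [apply vmeet_l|].
        apply (vle_trans (vmeet_r _ _ _)), vle_scal; [exact Ht|].
        apply vpos_lub; [|apply HSp].
        apply (vle_trans (y := S f)).
        + unfold w; op_vle_by (scal_ge0 F eps _ (Rlt_le _ _ Heps) (HSp e)).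
        + apply fragment_le; auto; apply HSu.
      - apply (Hpsup v (vpos_ge0 F _)); exists t; auto. }
    pose proof (Hqr _ _ (vpos_ge F (T e - k *: S e))) as F5; fold v in F5.
    rewrite (projD F C rho HC Hrho), (projN F C rho HC Hrho),
      (projZ F C rho HC Hrho) in F5.
    pose proof (Hqr _ _ (fragment_le T e f (proj1 HTu) HTp Hf)) as F6.
    rewrite Hk' in F5.
    (* On [rho], [T f] is bounded by [y]. Off [rho], it is at most [T e], hence at most [p v] plus
       [k] times [S e], and the latter is absorbed by [r] times [S f]. *)
    op_vle_by (leD (leD F1 (leD F4 (leD F5 F6)))
      (leD (vle_scal Hr F2) (vle_scal Hr F3))). }
  op_vle_by (leD H HMP). }
assert (Hp' : forall x, disj_compl (disj_compl (eq (S e))) (p x) /\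
  disj_compl (disj_compl (disj_compl (eq (S e)))) (x - p x)).
{ intros x; split; [apply Hp|].
  intros v Hv; apply vdisj_sym, Hv, Hp. }
(* Now [k] grows: [p] fixes the truncation of [T e] by [k *: S e], so [Hkey] bounds every truncation
   by the right-hand side, and their supremum is [p (T e)]. *)
assert (H : p (T e) <= y + p (T e) - (T e - P e)).
{ apply (Hpsup (T e) (HTp e)); intros z (k & Hk & ->).
  pose proof (Hkey k Hk) as H.
  rewrite vpos_sub_meet, (projD F _ p HBp Hp'), (projN F _ p HBp Hp') in H.
  rewrite (proj_unique F _ p HBp Hp' (T e ⊓ (k *: S e)) (T e ⊓ (k *: S e)))
    in H.
  - op_vle_by H.
  - intros v Hv; apply (vdisj_le F (k *: S e) v); [| apply vle_refl|].
    + rewrite !vabs_pos; auto using vmeet_r, vmeet_ge0, scal_ge0.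
    + apply vdisj_scall, vdisj_sym, Hv; reflexivity.
  - replace (T e ⊓ (k *: S e) - T e ⊓ (k *: S e)) with (0 : F) by vring.
    intros v _; apply vdisj0l. }
op_vle_by H.
Qed.

End Component.
End OperatorTheory.

Theorem mainTheorem2 (E F : VL) (HF : dedekind_complete F)
  (A : (E -> F) -> Prop)
  (HA : forall S, A S -> uryson S /\ positive_op S)
  (HAne : exists S0, A S0) (HAinc : increasing_set A)
  (T : E -> F) (HTu : uryson T) (HTp : positive_op T) :
  (exists Sg, is_sigma A T Sg) /\
  (forall Sg, is_sigma A T Sg ->
     forall e : E, is_inf (outer_set A T e) (Sg e)).
Proof.
destruct (component_exists E F HF A T HA HAne HAinc HTu HTp)
  as (P & HPu & HPp & HPT & HP).
pose proof (component_is_sigma E F HF A T HA HAne HAinc HTu HTp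
  P HPu HPp HPT HP) as Hsigma.
split; [eexists; exact Hsigma|].
intros Sg HSg e; rewrite (sigma_unique E F A T _ _ HSg Hsigma e).
split.
- intros y (eps & S & Heps & HS & Hy).
  exact (sigma_le_inner_sup E F HF A T HA HTu HTp P S eps e y HP HS Heps Hy).
- intros l Hl.
  (* As [P e] is a supremum of truncations, it is enough to bound each [M e] by [T e - l]. *)
  assert (H : vle (P e) (vadd (T e) (vopp l))).
  { apply HP; intros z (r & S & M & Hr & HS & HM & ->).
    assert (H : vle (vadd l (vopp (vadd (T e) (vopp (M e))))) vzero).
    { apply (archimedean HF (S e)); intros d Hd.
      (* This [eps] is positive with [r * eps <= d], also when [r] is zero; the error term is then
         at most [d] times [S e]. *)
      set (eps := (d / (r + 1))%R).
      assert (Heps : (0 < eps)%R).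
      { apply Rmult_lt_0_compat; [exact Hd|apply Rinv_0_lt_compat; lra]. }
      assert (Hd' : (r * eps <= d)%R).
      { replace d with ((r + 1) * eps)%R by (unfold eps; field; lra); nra. }
      destruct (HF (inner_set E F T S eps e)) as [y Hy].
      - exists vzero; apply (inner_set_nonempty E F A T); auto.
      - exists (T e); apply inner_set_bounded; auto.
      - assert (H1 : vle l y) by (apply Hl; exists eps, S; auto).
        pose proof (inner_sup_le E F A T HTu r S M eps e y Hr HS HM Hy) as H2.
        op_vle_by (leD (vle_trans H1 H2)
          (scal_le_scal F _ _ (S e) Hd' (proj2 (HA S HS) e))). }
    op_vle_by H. }
  op_vle_by H.
Qed.
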